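(* Let $p$ be a prime, let $a \ge 1$ be an integer, let $G$ be an Isaacs group of degree $p^a$, let $N$ be the unique minimal normal subgroup of $G$, and let $K = O_p(G)$. Then $p^a < |K:N| \le p^{2a}$, $N \le Z(K)$, $K$ is not abelian, and $|K:K'| \ge p^a$.
   Context: All groups are finite. For an integer $e > 1$, a group $G$ is an Isaacs group of degree $e$ if $|G| = e^4 - e^3$ and $d = e^2 - e$ is the degree of some irreducible complex character of $G$ (so that $|G| = d(d+e)$). It is known that an Isaacs group of degree $e$ has a unique minimal normal subgroup, which has order $e$. $O_p(G)$ is the largest normal $p$-subgroup of $G$, $Z(K)$ is the center of $K$, and $K'$ is the derived (commutator) subgroup of $K$. *)

(* Defs.v *)
From HB Require Import structures.
From mathcomp Require Import all_boot all_order all_algebra all_fingroup.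
From mathcomp Require Import all_solvable all_field all_character.

Set Implicit Arguments.
Unset Strict Implicit.
Unset Printing Implicit Defensive.

Import GroupScope GRing.Theory.

(* The truncated subtractions on nat are exact here because 1 < e. *)
Definition isaacs_group (e : nat) (gT : finGroupType) (G : {group gT}) : Prop :=
  [/\ (1 < e)%N,
      #|G| = (e ^ 4 - e ^ 3)%N
    & exists i : Iirr G, ('chi_i 1%g = (e ^ 2 - e)%N%:R)%R].

(* The library's minnormal N G does not require N to be contained in G. *)
Definition minimal_normal (gT : finGroupType) (N G : {group gT}) : bool :=
  [min N of M | M :!=: 1 & M <| G].

Definition unique_minimal_normal (gT : finGroupType) (N G : {group gT}) : Prop :=
  minimal_normal N G /\
  (forall M : {group gT}, minimal_normal M G -> M = N).

(* Main.v *)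
(* Put q = p ^ a, so |G| = q^3 (q - 1) and chi(1) = q (q - 1), and let P be a
   Sylow p-subgroup, of index q - 1.

   By Frobenius reciprocity a constituent mu of multiplicity m in chi|P has
   mu(1) >= q m.  Hence reg_P - q chi|P is a character, of degree q^2, so
   |chi| <= q on P^#; and every m mu(1) is a multiple of q, so chi|Z = q theta
   for Z <= Z(P) of order p.  The norm of theta modulo p forces |chi| = q on Z^#,
   integrality of central characters forces |z^G| = q - 1 for z in Z^#, and then
   [chi, chi] = 1 forces chi to vanish off {1} u z^G, which is therefore the
   common kernel of the other irreducible characters: it is N, of order q.

   Thus G is transitive on N^#, with Sylow p-subgroups as point stabilisers, and
   K = C_G(N).  The measure m(Y) = |C_G(Y)| |Y| on the subgroups 1 < Y <= N is
   supermodular, and m(Y) <= m(N) for all Y by induction on |N|: a maximal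
   counterexample X has TI conjugates, which partition N^#, and X can be enlarged
   to a proper subgroup Z with TI conjugates, against the induction hypothesis
   for N_G(Z) acting on Z.  What keeps Z proper is Baer-Suzuki: an element
   outside C_G(N) centralises at most sqrt |N| elements of N.  For Y = <z> this
   gives q^3 p <= |K| q, whence |K : N| > q; and an abelian K would give
   q (q - 1) = chi(1) <= |G : K|, that is |K| <= q^2.

   Finally, for a prime l <> p a Sylow l-subgroup T of G acts semiregularly on N,
   so it has a single subgroup <t> of order l and acts semiregularly on
   [K/K', t]; thus |T| divides p^i - 1 with p^i <= |K : K'|.  If |K : K'| < q this
   contradicts a weak form of Zsigmondy's theorem. *)
Require Import Defs.
From HB Require Import structures.
From mathcomp Require Import all_boot all_order all_algebra all_fingroup.
From mathcomp Require Import all_solvable all_field all_character.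

Set Implicit Arguments.
Unset Strict Implicit.
Unset Printing Implicit Defensive.

Import GroupScope GRing.Theory.

(** * Stabilisers in transitive actions on abelian p-groups *)

(** The index of [CP] in [A] divides both a p-number and a p'-number. *)
Lemma join_Sylow_pnat_index (p : nat) (gT : finGroupType) (A P C : {group gT}) :
  prime p -> p.-Sylow(A) P -> C <| A -> p.-nat #|A : C| -> C * P = A.
Proof.
move=> p_pr sylP /andP[sCA nCA] pAC.
have [sPA _ iAP] := and3P sylP.
have nCP := subset_trans sPA nCA.
rewrite -norm_joinEr //; apply/eqP; rewrite eqEsubset join_subG sCA sPA /=.
rewrite -indexg_eq1; apply/eqP/(@pnat_1 p).
  by apply: pnat_dvd pAC; apply: indexgS (joing_subl _ _).
by apply: pnat_dvd iAP; apply: indexgS (joing_subr _ _).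
Qed.

(** [A] is [C_A(V)] times a Sylow subgroup [P], and the nontrivial normal subgroup [V / X] of the
    p-group [VP / X] meets its centre. *)
Lemma pgroup_mod_cent_fix (p : nat) (gT : finGroupType) (A V X : {group gT}) :
    prime p -> p.-group V -> abelian V -> A \subset 'N(V) -> A \subset 'N(X) ->
    X \proper V -> p.-nat #|A : 'C_A(V)| ->
  exists2 v, v \in V :\: X & {in A, forall a, [~ v, a] \in X}.
Proof.
move=> p_pr pV abV nVA nXA /andP[sXV nsVX] pAC.
have nsCA: 'C_A(V) <| A by rewrite /normal subsetIl normsI ?normG ?norms_cent.
have [P sylP] := Sylow_exists p A.
have sPA := pHall_sub sylP.
have defA := join_Sylow_pnat_index p_pr sylP nsCA pAC.
have nVP := subset_trans sPA nVA; have nXP := subset_trans sPA nXA.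
have nXV: V \subset 'N(X) by rewrite cents_norm // centsC (subset_trans sXV).
pose L := (V <*> P)%G.
have pL: p.-group L by rewrite /= norm_joinEr // pgroupM pV (pHall_pgroup sylP).
have nsVL: V / X <| L / X.
  by rewrite quotient_normal // /normal joing_subl join_subG normG.
have ntVX: V / X != 1 by rewrite -subG1 quotient_sub1.
have := meet_center_nil (pgroup_nil (quotient_pgroup X pL)) nsVL ntVX.
case/trivgPn=> _ /setIP[/morphimP[v nXv Vv ->] Zv] ntv.
exists v.
  by rewrite inE Vv andbT; apply: contra ntv => Xv; rewrite /= coset_id.
have cPv: {in P, forall a, [~ v, a] \in X}.
  move=> a Pa; have nXa := subsetP nXP a Pa.
  rewrite coset_idr ?groupR ?morphR //=; apply/eqP/commgP.
  case/setIP: Zv => _ /centP; apply.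
  by rewrite mem_morphim // mem_gen // inE Pa orbT.
move=> a; rewrite -defA => /mulsgP[c b /setIP[_ cVc] Pb ->].
have cvc: [~ v, c] = 1 by apply/eqP/commgP/esym/(centP cVc).
by rewrite commgMJ cvc conj1g mulg1 cPv.
Qed.

(* G / C_G(V) acts faithfully on V; the conditions are phrased without this
   quotient so that N_G(Z) acting on Z <= V is again an instance. *)
Definition pstab_transitive (p : nat) (gT : finGroupType) (G V : {group gT}) :=
  [/\ p.-group V, abelian V, G \subset 'N(V),
      {in V^# &, forall u v, exists2 g, g \in G & v = u ^ g}
    & {in V^#, forall v, p.-nat #|'C_G[v] : 'C_G(V)|}].

(** Let [C = C_G(V)]. If [x] generates a p-group modulo [C] with each of its conjugates, Baer-Suzuki
    puts it in the preimage [R] of [O_p(G / C)]; the normal subgroup [R] fixes a point of [V^#],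
    hence by transitivity all of [V], a contradiction. *)
Lemma card_cent1_sq_leq (p : nat) (gT : finGroupType) (G V : {group gT}) x :
    prime p -> pstab_transitive p G V -> x \in G -> x \notin 'C(V) ->
  (#|'C_V[x]| ^ 2 <= #|V|)%N.
Proof.
move=> p_pr [pV abV nVG trG stG] Gx nCx.
pose C := 'C_G(V)%G.
have nsCG: C <| G by rewrite /normal subsetIl normsI ?normG ?norms_cent.
have nCG := normal_norm nsCG.
case: (boolP [forall y in G,
    p.-group <<[set coset C x; coset C x ^ coset C y]>>]).
  move/forall_inP=> pxy.
  have Qx: coset C x \in 'O_p(G / C).
    apply: Baer_Suzuki; first by rewrite mem_quotient.
    by move=> _ /morphimP[y _ Gy ->]; apply: pxy.
  have [R defR sCR nsRG] := inv_quotientN nsCG (pcore_normal p (G / C)).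
  have [sRG nRG] := andP nsRG.
  have nsCR: C <| R by rewrite (normalS sCR sRG).
  have Rx: x \in R.
    by rewrite -(quotientGK nsCR) -defR mem_morphpre // (subsetP nCG).
  have defC: 'C_R(V) = C.
    apply/eqP; rewrite eqEsubset setSI //= subsetI sCR /=.
    exact: subsetIr.
  have ntV: 1%G \proper V.
    rewrite proper1G; apply: contra nCx => /eqP->.
    by rewrite cent1T inE.
  have pRC: p.-nat #|R : 'C_R(V)|.
    by rewrite defC -card_quotient ?normal_norm // -defR; apply: pcore_pgroup.
  have nVR := subset_trans sRG nVG.
  have nR1: R \subset 'N(1%G) by rewrite norm1 subsetT.
  have [v] := pgroup_mod_cent_fix p_pr pV abV nVR nR1 ntV pRC.
  rewrite !inE => /andP[ntv Vv] cRv.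
  have cRv': v \in 'C(R).
    by apply/centP=> a Ra; apply/commgP; rewrite -in_set1; apply: cRv.
  case/negP: nCx; apply/centP=> w Vw.
  have [-> | ntw] := eqVneq w 1; first exact: commute1.
  have [||g Gg ->] := trG v w; rewrite ?inE ?ntv ?ntw //.
  have: v ^ g \in 'C(R) by rewrite memJ_norm // (subsetP (norms_cent nRG)).
  by move/centP=> cRvg; apply/commute_sym/cRvg.
rewrite negb_forall_in => /exists_inP[y Gy npxy].
have nVy: V :^ y = V by rewrite (normsP nVG).
(* A common fixed point [v] would put [x] and [x ^ y] in [C_G[v]], which is a p-group modulo [C]. *)
have ti: 'C_V[x] :&: 'C_V[x] :^ y = 1.
  apply/eqP; apply: contraR npxy => /trivgPn[v /setIP[/setIP[Vv cxv] cyv] ntv].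
  have V1v: v \in V^# by rewrite !inE ntv.
  have sCCv: C \subset 'C_G[v].
    by rewrite setIS // -cent_set1 centS // sub1set.
  have nCCv: 'C_G[v] \subset 'N(C) by rewrite (subset_trans (subsetIl _ _)).
  have pCv: p.-group ('C_G[v] / C) by rewrite /pgroup card_quotient ?stG.
  apply: pgroupS pCv; rewrite gen_subG subUset !sub1set -morphJ ?(subsetP nCG) //.
  move: cyv; rewrite mem_conjg => /setIP[_]; rewrite -mem_conjg -cent1J => cyv.
  by apply/andP; split; apply: mem_quotient; rewrite inE cent1C ?groupJ ?Gx.
have sCxV: 'C_V[x] * 'C_V[x] :^ y \subset V.
  by rewrite mul_subG ?subsetIl // -{2}nVy conjSg subsetIl.
by have:= subset_leq_card sCxV; rewrite TI_cardMg // cardJg.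
Qed.

(* A Chermak-Delgado measure. *)
Definition centmeas (gT : finGroupType) (G Y : {group gT}) :=
  (#|'C_G(Y)| * #|Y|)%N.

(** The centraliser of [Y <*> Z] is the intersection of those of [Y] and [Z], while their product
    lies in the centraliser of [Y :&: Z]. *)
Lemma centmeas_supermod (gT : finGroupType) (G V Y Z : {group gT}) :
    abelian V -> Y \subset V -> Z \subset V ->
  (centmeas G Y * centmeas G Z
    <= centmeas G (Y :&: Z) * centmeas G (Y <*> Z))%N.
Proof.
move=> abV sYV sZV; rewrite /centmeas /= [leqLHS]mulnACA [leqRHS]mulnACA.
have cZY: Z \subset 'C(Y).
  by rewrite (subset_trans sZV) // (subset_trans abV) // centS.
rewrite [leqRHS]mulnC (mulnC #|Y :&: Z|) {1}(cent_joinEr cZY) -mul_cardG.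
rewrite [leqLHS]mulnC leq_mul2l (mul_cardG 'C_G(Y)) centY -setIIr leq_mul2r.
apply/orP; right; apply/orP; right; apply: subset_leq_card.
by rewrite mul_subG // setIS // centS ?subsetIl ?subsetIr.
Qed.

Lemma centmeasJ (gT : finGroupType) (G Y : {group gT}) g :
  g \in G -> centmeas G (Y :^ g) = centmeas G Y.
Proof.
by move=> Gg; rewrite /centmeas centJ -{1}(conjGid Gg) -conjIg !cardJg.
Qed.

(** * Subgroups with TI conjugates *)

Definition TI_under (gT : finGroupType) (G X : {group gT}) :=
  {in G, forall g, X :&: X :^ g != 1 -> X :^ g = X}.

Lemma TI_underJ (gT : finGroupType) (G X : {group gT}) g h v :
    TI_under G X -> g \in G -> h \in G -> v != 1 ->
  v \in X :^ g -> v \in X :^ h -> X :^ g = X :^ h.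
Proof.
move=> tiX Gg Gh ntv Xgv Xhv.
have XhgE: X :^ (h * g^-1) = X.
  apply: tiX; first by rewrite groupM ?groupV.
  apply/trivgPn; exists (v ^ g^-1); last by rewrite conjg_eq1.
  by rewrite inE -mem_conjg Xgv -mem_conjg -conjsgM mulgKV.
by rewrite -{1}XhgE -conjsgM mulgKV.
Qed.

(** If [g] centralises some [y != 1] in [X], then [y] lies in [X :&: X :^ g], so [g] normalises
    [X]. *)
Lemma cent_normTI (gT : finGroupType) (G X Y : {group gT}) :
    TI_under G X -> Y \subset X -> Y :!=: 1 ->
  'C_('N_G(X))(Y) = 'C_G(Y).
Proof.
move=> tiX sYX /trivgPn[y Yy nty]; apply/eqP.
rewrite eqEsubset setSI ?subsetIl //=; apply/subsetP=> g /setIP[Gg cYg].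
rewrite !inE Gg cYg andbT /= tiX //.
apply/trivgPn; exists y; rewrite // inE (subsetP sYX) //=.
have {1}<-: y ^ g = y by rewrite conjgE -(centP cYg) // mulKg.
by rewrite memJ_conjg (subsetP sYX).
Qed.

(** This passes to a smaller instance in the induction: by the TI condition, an element of [G]
    fusing two elements of [X^#] normalises [X]. *)
Lemma pstab_transitive_normTI (p : nat) (gT : finGroupType)
    (G V X : {group gT}) :
    pstab_transitive p G V -> X \subset V -> TI_under G X ->
  pstab_transitive p 'N_G(X) X.
Proof.
move=> [pV abV nVG trG stG] sXV tiX; split.
- exact: pgroupS pV.
- exact: abelianS abV.
- exact: subsetIr.
- move=> u v /setD1P[ntu Xu] /setD1P[ntv Xv].
  have [||g Gg Dv] := trG u v; rewrite ?inE ?ntu ?ntv ?(subsetP sXV) //.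
  exists g; rewrite // !inE Gg /=.
  have:= @TI_underJ _ _ _ g 1 v tiX Gg (group1 G) ntv.
  rewrite conjsg1 => ->; rewrite ?subxx //.
  by rewrite Dv memJ_conjg.
move=> v /setD1P[ntv Xv].
have sv: <[v]> \subset X by rewrite cycle_subG.
have ntX: X :!=: 1 by apply/trivgPn; exists v.
rewrite /= -cent_cycle !(cent_normTI tiX) // ?cycle_eq1 //.
have:= stG v; rewrite !inE ntv (subsetP sXV) // => /(_ isT).
by apply: pnat_dvd; rewrite cent_cycle; apply: indexgS; rewrite setIS ?centS.
Qed.

(** The nontrivial conjugates of [X] inside [Z], with 1 removed, partition [Z^#] into blocks of
    equal size. *)
Lemma card_spread_dvd (gT : finGroupType) (G X Z : {group gT}) :
    TI_under G X ->
    {in Z^#, forall v, exists2 g, g \in G & v \in X :^ g} ->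
    {in G, forall g, Z :&: X :^ g != 1 -> X :^ g \subset Z} ->
  #|X|.-1 %| #|Z|.-1.
Proof.
move=> tiX covX clZ.
pose P := [set (X :^ g)^# | g in [set g in G | (X :^ g != 1) && (X :^ g \subset Z)]].
have cardP: {in P, forall A : {set gT}, #|A| = #|X|.-1}.
  move=> _ /imsetP[g _ ->]; rewrite -(cardJg X g).
  by rewrite [in RHS](cardsD1 1) group1.
have partP: partition P Z^#.
  apply/and3P; split.
  - rewrite eqEsubset; apply/andP; split.
      apply/bigcupsP=> _ /imsetP[g /[!inE] /and3P[_ _ sXZ] ->].
      exact: setSD.
    apply/subsetP=> v Zv; have /setD1P[ntv Zv'] := Zv.
    have [g Gg Xgv] := covX v Zv.
    apply/bigcupP; exists (X :^ g)^#; last by rewrite !inE ntv.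
    apply/imsetP; exists g; rewrite // inE Gg.
    have ntXg: X :^ g != 1 by apply/trivgPn; exists v.
    by rewrite ntXg clZ //; apply/trivgPn; exists v; rewrite // inE Zv'.
  - apply/trivIsetP=> A B /imsetP[g /[!inE] /and3P[Gg _ _] ->].
    move=> /imsetP[h /[!inE] /and3P[Gh _ _] ->]; apply: contraR.
    case/pred0Pn=> v /andP[/setD1P[ntv Xgv] /setD1P[_ Xhv]].
    by rewrite (TI_underJ tiX Gg Gh ntv).
  apply/negP=> /imsetP[g /[!inE] /and3P[_ ntX _]] /esym/eqP.
  by rewrite setD_eq0 => sX1; case/negP: ntX; rewrite -subG1.
have:= card_uniform_partition cardP partP; rewrite [#|Z|](cardsD1 1) group1.
by move=> /= ->; apply: dvdn_mull.
Qed.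

(** * Divisibility among the numbers p^n - 1 *)

Lemma dvdn_pred_exp (p d n : nat) :
  (1 < p)%N -> ((p ^ d).-1 %| (p ^ n).-1)%N = (d %| n)%N.
Proof.
move=> p_gt1; have p_gt0 := ltnW p_gt1.
have dvd_mul k: ((p ^ d).-1 %| (p ^ (d * k)).-1)%N.
  by rewrite expnM; apply: dvdn_pred_predX.
apply/idP/idP=> [|/dvdnP[k ->]]; last by rewrite mulnC.
have [->|d_gt0] := posnP d.
  by rewrite expn0 /= !dvd0n -subn1 subn_eq0 -{1}(expn0 p) leq_exp2l // leqn0.
pose s := (n %% d)%N; pose k := (n %/ d)%N.
have -> : (p ^ n = p ^ s * p ^ (d * k))%N.
  by rewrite -expnD addnC mulnC -divn_eq.
move=> dvd_n.
have: ((p ^ d).-1 %| (p ^ s).-1)%N.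
  rewrite -(dvdn_addr _ (dvdn_mull (p ^ s) (dvd_mul k))).
  suff -> : (p ^ s * (p ^ (d * k)).-1 + (p ^ s).-1 =
             (p ^ s * p ^ (d * k)).-1)%N by [].
  rewrite -!subn1 mulnBr muln1 addnBA ?expn_gt0 ?p_gt0 // subnK //.
  by rewrite leq_pmulr // expn_gt0 p_gt0.
move=> dvd_s; have [s0|s_gt0] := posnP s; first by rewrite /dvdn -/s s0.
suff: ~~ ((p ^ d).-1 %| (p ^ s).-1)%N by rewrite dvd_s.
rewrite gtnNdvd //.
  by rewrite ltn_predRL -(expn0 p) ltn_exp2l.
by rewrite ltn_predRL prednK ?expn_gt0 ?p_gt0 // ltn_exp2l // ltn_mod.
Qed.

(** For the exponents d, n, m of [x], [y], [w]: d divides n and m, so 2n <= m < 2n + d forces m =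
    2n. *)
Lemma pnat_sq_squeeze (p x y w : nat) :
    prime p -> p.-nat x -> p.-nat y -> p.-nat w ->
    (x.-1 %| y.-1)%N -> (x.-1 %| w.-1)%N ->
    (y ^ 2 <= w)%N -> (w < y ^ 2 * x)%N ->
  (y ^ 2)%N = w.
Proof.
move=> p_pr px py pw; have p_gt1 := prime_gt1 p_pr.
have [d ->] := p_natP px; have [n ->] := p_natP py; have [m ->] := p_natP pw.
rewrite !dvdn_pred_exp // -!expnM -expnD leq_exp2l // ltn_exp2l // => dn dm.
move=> le_nm lt_m; congr (p ^ _)%N; apply/eqP; rewrite eqn_leq le_nm /=.
rewrite -subn_eq0; apply/eqP/eqP; rewrite -leqn0 leqNgt; apply/negP=> m_gt0.
have := dvdn_leq m_gt0 (dvdn_sub dm (dvdn_mulr 2 dn)).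
by rewrite leqNgt ltn_subLR // lt_m.
Qed.

(** * A subgroup [X] of maximal measure, and of maximal order among those, when [V] has smaller
    measure *)

Section MaximalMeasure.

Variables (p : nat) (gT : finGroupType) (G V X : {group gT}).

Hypotheses (p_pr : prime p) (hGV : pstab_transitive p G V).
Hypotheses (sXV : X \subset V) (ntX : X :!=: 1).
Hypothesis maxX : forall Z : {group gT},
  Z \subset V -> Z :!=: 1 -> (centmeas G Z <= centmeas G X)%N.
Hypothesis max_cardX : forall Z : {group gT},
  Z \subset V -> Z :!=: 1 -> (centmeas G X <= centmeas G Z)%N ->
  (#|Z| <= #|X|)%N.
Hypothesis gtXV : (centmeas G V < centmeas G X)%N.

Let pV : p.-group V. Proof. by case: hGV. Qed.
Let abV : abelian V. Proof. by case: hGV. Qed.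
Let nVG : G \subset 'N(V). Proof. by case: hGV. Qed.

Let sXgV g : g \in G -> X :^ g \subset V.
Proof. by move=> Gg; rewrite -(normsP nVG g Gg) conjSg. Qed.

(** In the supermodular inequality for [Z] and [X :^ g], the intersection has at most the measure of
    [X], which cancels. *)
Lemma centmeas_join_max (Z : {group gT}) g :
    g \in G -> Z \subset V -> Z :&: X :^ g != 1 ->
  (centmeas G Z <= centmeas G (Z <*> X :^ g))%N.
Proof.
move=> Gg sZV ntZX; have sXg := sXgV Gg.
have:= centmeas_supermod G abV sZV sXg; rewrite (centmeasJ _ Gg) => leZX.
have leI: (centmeas G (Z :&: X :^ g) <= centmeas G X)%N.
  by apply: maxX; rewrite // subIset ?sZV.
have m_gt0: (0 < centmeas G X)%N by rewrite muln_gt0 !cardG_gt0.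
rewrite -(leq_pmul2r m_gt0) (leq_trans leZX) // mulnC.
by rewrite leq_mul2l leI orbT.
Qed.

(** If [X] meets [X :^ g], their join also has maximal measure, so it is no larger than [X]. *)
Lemma maximal_TI : TI_under G X.
Proof.
move=> g Gg ntI; have le_m := centmeas_join_max Gg sXV ntI.
have sJV: X <*> X :^ g \subset V by rewrite join_subG sXV sXgV.
have ntJ: X <*> X :^ g != 1.
  by apply: contra ntX; rewrite -!subG1; apply: subset_trans (joing_subl _ _).
have leJ := max_cardX sJV ntJ le_m.
have/eqP defX: X :==: X <*> X :^ g by rewrite eqEcard joing_subl.
by apply/eqP; rewrite eqEcard cardJg leqnn {2}defX joing_subr.
Qed.

Lemma maximal_cover : {in V^#, forall v, exists2 g, g \in G & v \in X :^ g}.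
Proof.
move=> v V1v; have [_ _ _ trG _] := hGV; have [x Xx ntx] := trivgPn _ ntX.
have V1x: x \in V^# by rewrite !inE ntx (subsetP sXV).
have [g Gg ->] := trG x v V1x V1v.
by exists g; rewrite // memJ_conjg.
Qed.

(** An element of [G] outside [C_G(V)] centralises at most sqrt |V| elements of [V]. *)
Lemma cent_large (Z : {group gT}) :
  Z \subset V -> (#|V| < #|Z| ^ 2)%N -> 'C_G(Z) = 'C_G(V).
Proof.
move=> sZV ltVZ; apply/eqP; rewrite eqEsubset [X in _ && X]setIS ?centS //.
rewrite andbT; apply/subsetP=> x /setIP[Gx cZx]; rewrite inE Gx /=.
apply: contraLR ltVZ => nCx; rewrite -leqNgt.
apply: leq_trans (card_cent1_sq_leq p_pr hGV Gx nCx).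
rewrite leq_exp2r // subset_leq_card // subsetI sZV.
by rewrite -(sub_cent1 Z) in cZx.
Qed.

Lemma card_cent_max_gt : (#|'C_G(V)| < #|'C_G(X)|)%N.
Proof.
rewrite ltnNge; apply: contraL gtXV => leC; rewrite -leqNgt.
by rewrite leq_mul // subset_leq_card.
Qed.

Lemma card_max_sq : (#|X| ^ 2 <= #|V|)%N.
Proof.
rewrite leqNgt; apply: contraL card_cent_max_gt => ltVX.
by rewrite -leqNgt (cent_large sXV ltVX).
Qed.

(* ext Z / Z is the group of C_G(Z)-fixed points of V / Z. *)
Let ext (Z : {set gT}) : {set gT} :=
  [set v in V | [forall c in 'C_G(Z), [~ v, c] \in Z]].

Lemma sub_ext (Z : {group gT}) : Z \subset V -> Z \subset ext Z.
Proof.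
move=> sZV; apply/subsetP=> z Zz; rewrite inE (subsetP sZV) //=.
apply/forall_inP=> c /setIP[_ cZc].
by have/commgP/eqP-> := commute_sym (centP cZc z Zz).
Qed.

Lemma extJ (Z : {set gT}) g : g \in G -> ext (Z :^ g) = ext Z :^ g.
Proof.
move=> Gg; have sub h Y: h \in G -> ext Y :^ h \subset ext (Y :^ h).
  move=> Gh; apply/subsetP=> _ /imsetP[v /[!inE] /andP[Vv /forall_inP cYv] ->].
  rewrite memJ_norm ?(subsetP nVG) // Vv /=.
  apply/forall_inP=> c; rewrite -{1}(conjGid Gh) centJ -conjIg => /imsetP[d Cd ->].
  by rewrite -conjRg memJ_conjg cYv.
apply/eqP; rewrite eqEsubset sub // andbT.
by have:= sub g^-1 (Z :^ g); rewrite groupV conjsgK sub_conjgV; apply.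
Qed.

(** This condition survives conjugation in [G] and intersection, so that a smallest closed subgroup
    over [X] will have TI conjugates. *)
Let closed (Z : {set gT}) :=
  (Z \subset V)
  && [forall g in G, (Z :&: X :^ g != 1) ==> (ext (X :^ g) \subset Z)].

Let closedP (Z : {set gT}) : reflect
  (Z \subset V /\ {in G, forall g, Z :&: X :^ g != 1 -> ext (X :^ g) \subset Z})
  (closed Z).
Proof.
apply: (iffP andP) => [] [sZV clZ]; split=> //.
  by move=> g Gg ntI; apply: (implyP (forall_inP clZ g Gg)).
by apply/forall_inP=> g Gg; apply/implyP=> ntI; apply: clZ.
Qed.

Let closedJ (Z : {set gT}) g : g \in G -> closed Z -> closed (Z :^ g).
Proof.
move=> Gg /closedP[sZV clZ]; apply/closedP; split=> [|h Gh ntI].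
  by rewrite -(normsP nVG g Gg) conjSg.
have Ghg: h * g^-1 \in G by rewrite groupM ?groupV.
have defXh: X :^ h = (X :^ (h * g^-1)) :^ g by rewrite -conjsgM mulgKV.
rewrite defXh extJ // conjSg clZ //.
by apply: contra ntI => /eqP tiZ; rewrite defXh -conjIg tiZ conjs1g.
Qed.

Let closedI (Y Z : {group gT}) : closed Y -> closed Z -> closed (Y :&: Z).
Proof.
move=> /closedP[sYV clY] /closedP[_ clZ]; apply/closedP.
split=> [|g Gg ntI]; first by rewrite subIset ?sYV.
rewrite subsetI clY ?clZ //; apply: contra ntI; rewrite -!subG1.
  by apply: subset_trans; rewrite setSI ?subsetIr.
by apply: subset_trans; rewrite setSI ?subsetIl.
Qed.

(* Giving |Z| weight 2 leaves room for the enlargements below: joining to Z a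
   conjugate X ^ g that meets ext (X ^ h), X ^ h <= Z, divides |C_G(Z)| by at
   most |X| ^ 2. *)
Let half (Z : {group gT}) :=
  [&& X \subset Z, Z \subset V, #|Z| ^ 2 <= #|V|
    & #|'C_G(X)| * #|X| ^ 2 <= #|'C_G(Z)| * #|Z| ^ 2]%N.

Let lt_measure : (#|'C_G(V)| * #|V| < #|'C_G(X)| * #|X|)%N := gtXV.

(** * A largest subgroup satisfying [half] *)

Section HalfMaximal.

Variable Y : {group gT}.
Hypotheses (halfY : half Y).
Hypothesis maxY : forall Z : {group gT}, half Z -> (#|Z| <= #|Y|)%N.

Let sXY : X \subset Y. Proof. by case/and4P: halfY. Qed.
Let sYV : Y \subset V. Proof. by case/and4P: halfY. Qed.
Let sqY : (#|Y| ^ 2 <= #|V|)%N. Proof. by case/and4P: halfY. Qed.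
Let geY : (#|'C_G(X)| * #|X| ^ 2 <= #|'C_G(Y)| * #|Y| ^ 2)%N.
Proof. by case/and4P: halfY. Qed.

(** Only the bound on [|Z| ^ 2] can keep the larger subgroup [Z] from satisfying [half]; then
    [cent_large] applies. *)
Let half_max (Z : {group gT}) :
    Y \subset Z -> Z \subset V -> (#|Y| < #|Z|)%N ->
    (#|'C_G(Y)| * #|Y| ^ 2 <= #|'C_G(Z)| * #|Z| ^ 2)%N ->
  (#|V| < #|Z| ^ 2)%N /\ 'C_G(Z) = 'C_G(V).
Proof.
move=> sYZ sZV ltYZ leYZ.
have ltVZ: (#|V| < #|Z| ^ 2)%N.
  rewrite ltnNge; apply: contraL ltYZ => sqZ; rewrite -leqNgt maxY //.
  by apply/and4P; rewrite (subset_trans sXY) // (leq_trans geY).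
by rewrite cent_large.
Qed.

(** Otherwise [Z = Y <*> X :^ g] has centraliser [C_G(V)], and |C_G(X)||X|^2 <= |C_G(Y)||Y|^2 <=
    |C_G(V)||Z||Y| <= |C_G(V)||V||X| contradicts the choice of [X]. *)
Lemma half_max_cover g : g \in G -> Y :&: X :^ g != 1 -> X :^ g \subset Y.
Proof.
move=> Gg ntI; apply: contraR ntI => nsXgY; apply/negPn/negP=> ntI.
have sXg := sXgV Gg; pose Z := (Y <*> X :^ g)%G.
have sYZ: Y \subset Z := joing_subl _ _.
have sZV: Z \subset V by rewrite join_subG sYV.
have ltYZ: (#|Y| < #|Z|)%N.
  rewrite proper_card // properE sYZ; apply: contra nsXgY => sZY.
  exact: subset_trans (joing_subr _ _) sZY.
have leYZ: (#|'C_G(Y)| * #|Y| <= #|'C_G(Z)| * #|Z|)%N.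
  exact: centmeas_join_max.
have cardZ: (#|Z| <= #|Y| * #|X|)%N.
  rewrite /= cent_joinEr -?(cardJg X g) ?mul_cardG ?leq_pmulr ?cardG_gt0 //.
  by rewrite (subset_trans sXg) // (subset_trans abV) // centS.
have [|ltVZ defC] := half_max sYZ sZV ltYZ.
  by rewrite !expnS !expn0 !muln1 !mulnA leq_mul // ltnW.
have := lt_measure; rewrite ltnNge => /negP[].
rewrite -(leq_pmul2r (cardG_gt0 X)) -mulnA mulnn (leq_trans geY) //.
rewrite -mulnn mulnA (leq_trans (leq_mul leYZ (leqnn _))) // defC.
rewrite -!mulnA leq_mul2l; apply/orP; right.
by rewrite (leq_trans (leq_mul cardZ (leqnn _))) // mulnAC mulnn leq_mul.
Qed.

(** For [v] in [ext (X :^ g)] outside [Y], adjoin first [v], then the conjugate [X :^ h] containing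
    it: each enlargement costs a controlled part of the centraliser. *)
Lemma half_max_closed : closed Y.
Proof.
apply/closedP; split=> // g Gg ntI; have sXgY := half_max_cover Gg ntI.
apply/subsetP=> v /[!inE] /andP[Vv /forall_inP cXv]; apply: contraT => nYv.
have ntv: v != 1 by apply: contraNneq nYv => ->.
have V1v: v \in V^# by rewrite !inE ntv.
have [h Gh Xhv] := maximal_cover V1v.
have tiYX: Y :&: X :^ h = 1.
  apply/eqP; apply: contraR nYv => ntYX.
  exact: subsetP (half_max_cover Gh ntYX) v Xhv.
have sXh := sXgV Gh.
have cYX: X :^ h \subset 'C(Y).
  by rewrite (subset_trans sXh) // (subset_trans abV) // centS.
pose Y1 := (Y <*> <[v]>)%G; pose Z := (Y <*> X :^ h)%G.
have sYZ: Y \subset Z := joing_subl _ _.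
have sZV: Z \subset V by rewrite join_subG sYV.
have sYY1: Y \subset Y1 := joing_subl _ _.
have Y1v: v \in Y1 by rewrite -cycle_subG joing_subr.
have sY1V: Y1 \subset V by rewrite join_subG sYV cycle_subG.
have ltYY1: (#|Y| < #|Y1|)%N.
  by rewrite proper_card // properE sYY1; apply: contra nYv => /subsetP->.
have cardZ: (#|Z| = #|Y| * #|X|)%N by rewrite /= cent_joinEr // TI_cardMg ?cardJg.
have defCY1: 'C_G(Y1) = 'C_('C_G(Y))[v] by rewrite centY cent_cycle setIA.
(* As [C_G(Y)] centralises [X :^ g], the orbit of [v] under it lies in the coset of [X :^ g]
   containing [v]. *)
have leCY: (#|'C_G(Y)| <= #|'C_G(Y1)| * #|X|)%N.
  rewrite defCY1 -(Lagrange (subsetIl 'C_G(Y) 'C[v])) leq_mul2l index_cent1.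
  rewrite -(cardJg X g) -(card_lcoset (X :^ g) v) subset_leq_card ?orbT //.
  apply/subsetP=> _ /imsetP[c CYc ->]; rewrite mem_lcoset -commgEl.
  by apply: cXv; apply: (subsetP (setIS G (centS sXgY))).
have leY1Z: (#|'C_G(Y1)| * #|Y1| <= #|'C_G(Z)| * #|Z|)%N.
  have <-: (Y1 <*> X :^ h)%G = Z.
    apply/val_inj; rewrite /= -joingA; congr (_ <*> _).
    by apply/joing_idPr; rewrite cycle_subG.
  apply: centmeas_join_max => //.
  by apply/trivgPn; exists v; rewrite // inE Y1v.
have ltCYZ: (#|'C_G(Y)| < #|'C_G(Z)| * #|X| ^ 2)%N.
  rewrite -(ltn_pmul2r (cardG_gt0 Y)).
  apply: (@leq_trans (#|'C_G(Y)| * #|Y1|)); first by rewrite ltn_pmul2l ?cardG_gt0.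
  apply: leq_trans (leq_mul leCY (leqnn _)) _; rewrite mulnAC.
  apply: leq_trans (leq_mul leY1Z (leqnn _)) _.
  by rewrite cardZ -!mulnA leq_mul2l (mulnC #|Y|) -mulnA leqnn orbT.
have ltYZ: (#|Y| < #|Z|)%N.
  by rewrite (leq_trans ltYY1) // subset_leq_card // join_subG sYZ cycle_subG
             (subsetP (joing_subr _ _)).
have [|ltVZ defCZ] := half_max sYZ sZV ltYZ.
  rewrite cardZ expnMn (mulnC (#|Y| ^ 2)%N) [leqRHS]mulnA leq_mul2r.
  by rewrite (ltnW ltCYZ) orbT.
rewrite defCZ in ltCYZ.
have ltVY: (#|V| < #|Y| ^ 2 * #|X|)%N.
  rewrite -(ltn_pmul2l (cardG_gt0 'C_G(V))) (ltn_trans lt_measure) //.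
  rewrite mulnA ltn_pmul2r ?cardG_gt0 //.
  have x2_gt0 : (0 < #|X| ^ 2)%N by rewrite expn_gt0 cardG_gt0.
  rewrite -(ltn_pmul2r x2_gt0) (leq_ltn_trans geY) // mulnAC.
  by rewrite ltn_pmul2r // expn_gt0 cardG_gt0.
(* Conjugates of [X] partition both [Y^#] and [V^#], so |X| - 1 divides |Y| - 1 and |V| - 1; with
   [ltVY] this leaves only equality. *)
have defV: (#|Y| ^ 2)%N = #|V|.
  apply: (@pnat_sq_squeeze p #|X|) => //.
  - exact: pgroupS sXV pV.
  - exact: pgroupS sYV pV.
  - apply: (card_spread_dvd maximal_TI) => [u Yu|k Gk ntYX].
      by apply: maximal_cover; apply: subsetP (setSD _ sYV) u Yu.
    exact: half_max_cover.
  - apply: (card_spread_dvd maximal_TI maximal_cover) => k Gk _.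
    exact: sXgV.
(* Now [Y1], being larger than [Y], exceeds sqrt |V|, and [leCY] bounds |C_G(Y)| by |C_G(V)||X|,
   against [lt_measure]. *)
have defCV: 'C_G(Y1) = 'C_G(V).
  by rewrite cent_large // -defV ltn_exp2r.
have := lt_measure; rewrite ltnNge => /negP[].
rewrite -(leq_pmul2r (cardG_gt0 X)) -mulnA mulnn (leq_trans geY) //.
by rewrite defV mulnAC leq_mul2r -defCV leCY orbT.
Qed.

End HalfMaximal.

(** [Z] is a smallest closed subgroup over [X]; a largest [half] subgroup is closed and bounds its
    order. *)
Lemma maximal_TI_overgroup :
  exists Z : {group gT}, [/\ X \proper Z, Z \subset V, (#|Z| ^ 2 <= #|V|)%N
                            & TI_under G Z].
Proof.
have halfX: half X by rewrite /half subxx sXV card_max_sq leqnn.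
have [Y halfY maxY] := @arg_maxnP _ X half (fun Z => #|Z|) halfX.
have [sXY _ sqY _] := and4P halfY.
pose cl (Z : {group gT}) := (X \subset Z) && closed Z.
have clY: cl Y by rewrite /cl sXY half_max_closed.
have [Z /andP[sXZ clZ] minZ] := @arg_minnP _ Y cl (fun Z => #|Z|) clY.
have [sZV coverZ] := closedP Z clZ.
have sEZ: ext X \subset Z.
  by have:= coverZ 1 (group1 G); rewrite conjsg1 (setIidPr sXZ); apply.
exists Z; split=> //; last first.
(* The closed subgroup [Z :&: Z :^ h] contains the conjugate [X :^ g] through [v]; conjugated back
   by [g^-1] it competes with [Z], so minimality gives it order |Z|. *)
- move=> h Gh /trivgPn[v /setIP[Zv Zhv] ntv].
  have V1v: v \in V^# by rewrite !inE ntv (subsetP sZV).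
  have [g Gg Xgv] := maximal_cover V1v.
  have Ggi: g^-1 \in G by rewrite groupV.
  pose I := (Z :&: Z :^ h)%G.
  have clI: closed I by apply: (@closedI Z (Z :^ h)%G) => //; apply: closedJ.
  have sXgI: X :^ g \subset I.
    have [_ clIg] := closedP I clI.
    apply: subset_trans (clIg g Gg _); first by rewrite extJ // conjSg sub_ext.
    by apply/trivgPn; exists v; rewrite // !inE Zv Zhv.
  have leZI: (#|Z| <= #|I|)%N.
    rewrite -(cardJg I g^-1); apply: (minZ (I :^ g^-1)%G).
    by rewrite /cl /= -sub_conjg sXgI closedJ.
  have defI: I :=: Z by apply/eqP; rewrite eqEcard subsetIl leZI.
  have sZZh: Z \subset Z :^ h by rewrite -{1}defI subsetIr.
  by apply/esym/eqP; rewrite eqEcard sZZh cardJg leqnn.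
- by apply: leq_trans sqY; rewrite leq_exp2r // minZ.
(* If [Z = X] then [ext X] lies in [X]; but [C_G(X)] acts on [V / X] as a p-group and fixes a
   nontrivial point. *)
rewrite properE sXZ /=; apply/negP=> sZX.
have [x Xx ntx] := trivgPn _ ntX.
have [_ _ _ _ stG] := hGV.
have V1x: x \in V^# by rewrite !inE ntx (subsetP sXV).
have ltXV: X \proper V.
  rewrite properE sXV; apply: contraL gtXV => sVX.
  have -> : V = X by apply/val_inj/eqP; rewrite eqEsubset sVX.
  by rewrite ltnn.
have nXC: 'C_G(X) \subset 'N(X) by rewrite subIset // cent_sub orbT.
have pC: p.-nat #|'C_G(X) : 'C_('C_G(X))(V)|.
  have -> : 'C_('C_G(X))(V) = 'C_G(V).
    by rewrite -setIA; congr (_ :&: _); apply/setIidPr/centS.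
  apply: pnat_dvd (stG x V1x); apply: indexSg; first by rewrite setIS ?centS.
  by rewrite /= setIS // -cent_set1 centS // sub1set.
have nVC: 'C_G(X) \subset 'N(V) by rewrite subIset ?nVG.
have [v] := pgroup_mod_cent_fix p_pr pV abV nVC nXC ltXV pC.
rewrite inE => /andP[nXv Vv] cXv; case/negP: nXv.
apply: (subsetP sZX); apply: (subsetP sEZ); rewrite inE Vv.
exact/forall_inP.
Qed.

End MaximalMeasure.

(** In a counterexample, the TI overgroup [Z] of a maximal [X] with the action of [N_G(Z)] is a
    smaller instance with the same centralisers; there [X] has at most the measure of [Z], against
    the maximal order of [X]. *)
Lemma centmeas_leq (p : nat) (gT : finGroupType) (G V Y : {group gT}) :
    prime p -> pstab_transitive p G V -> Y \subset V -> Y :!=: 1 ->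
  (centmeas G Y <= centmeas G V)%N.
Proof.
move=> p_pr; have [n] := ubnP #|V|; elim: n => // n IHn in G V Y *.
move=> /ltnSE-leVn hGV sYV ntY; rewrite leqNgt; apply/negP=> ltVY.
(* Lexicographic order: since |Z| <= |V|, the measure decides first and the order breaks ties. *)
pose weight (Z : {group gT}) := (centmeas G Z * #|V|.+1 + #|Z|)%N.
pose sub1 (Z : {group gT}) := (Z \subset V) && (Z :!=: 1).
have subY: sub1 Y by rewrite /sub1 sYV.
have [X /andP[sXV ntX] maxX] := @arg_maxnP _ Y sub1 weight subY.
have maxmX (Z : {group gT}) :
  Z \subset V -> Z :!=: 1 -> (centmeas G Z <= centmeas G X)%N.
- move=> sZV ntZ; rewrite leqNgt; apply/negP=> ltXZ.
  have: (weight Z <= weight X)%N by apply: maxX; rewrite /sub1 sZV.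
  apply/negP; rewrite -ltnNge /weight.
  apply: (@leq_trans ((centmeas G X).+1 * #|V|.+1)).
    by rewrite mulSn addnC ltn_add2r ltnS subset_leq_card.
  by apply: leq_trans (leq_addr _ _); rewrite leq_mul2r ltXZ orbT.
have maxcX (Z : {group gT}) : Z \subset V -> Z :!=: 1 ->
  (centmeas G X <= centmeas G Z)%N -> (#|Z| <= #|X|)%N.
- move=> sZV ntZ leXZ.
  have: (weight Z <= weight X)%N by apply: maxX; rewrite /sub1 sZV.
  have eqXZ: centmeas G X = centmeas G Z by apply/eqP; rewrite eqn_leq leXZ maxmX.
  by rewrite /weight eqXZ leq_add2l.
have gtXV: (centmeas G V < centmeas G X)%N by rewrite (leq_trans ltVY) ?maxmX.
have [Z [ltXZ sZV sqZ tiZ]] :=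
  maximal_TI_overgroup p_pr hGV sXV ntX maxmX maxcX gtXV.
have [sXZ _] := andP ltXZ.
have ntZ: Z :!=: 1 by apply: contra ntX; rewrite -!subG1; apply: subset_trans.
have ltZV: (#|Z| < #|V|)%N.
  by apply: leq_trans sqZ; rewrite -mulnn ltn_Pmull ?cardG_gt0 ?cardG_gt1.
have hZ := pstab_transitive_normTI hGV sZV tiZ.
have := IHn 'N_G(Z)%G Z X (leq_trans ltZV leVn) hZ sXZ ntX.
rewrite /centmeas !(cent_normTI tiZ) // => leXZ.
by have := proper_card ltXZ; rewrite ltnNge maxcX.
Qed.

(** * A weak form of Zsigmondy's theorem *)

Section Zsigmondy.

Local Open Scope ring_scope.
Import Num.Theory Order.TTheory.

(** Every factor q - z^k has modulus at least q - 1 >= 1, and strictly more than q - 1 for k = 1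
    because z is not 1. *)
Lemma Cyclotomic_horner_neq (n q : nat) :
  (1 < n)%N -> (1 < q)%N -> (`|('Phi_n).[q%:Z]| != 1)%N.
Proof.
move=> n_gt1 q_gt1; have n_gt0 := ltnW n_gt1.
have [z z_prim] := C_prim_root_exists n_gt0.
have n1z: `|z| = 1.
  apply/eqP; rewrite -(pexpr_eq1 n_gt0) // -normrX prim_expr_order //.
  by rewrite normr1.
have ltz: `|q%:R : algC| - `|z| < `|q%:R - z|.
  rewrite lt_neqAle lerB_dist andbT; apply/negP=> /eqP/esym/normCBeq[t n1t [Dq Dz]].
  have z1: z = 1.
    rewrite Dz n1z mul1r; apply: (mulfI (x := q%:R)).
      by rewrite pnatr_eq0 -lt0n ltnW.
    by rewrite mulr1 -[in LHS](normr_nat algC) -Dq.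
  by have:= prim_order_dvd z_prim 1%N; rewrite z1 expr1n eqxx dvdn1 gtn_eqF.
have geq1 k : 1 <= `|q%:R - z ^+ k|.
  apply: le_trans (lerB_dist _ _); rewrite normr_nat normrX n1z expr1n.
  by rewrite lerBrDr (ler_nat _ 2).
have : 1 < `|(cyclotomic z n).[q%:R]|.
  rewrite horner_prod normr_prod (bigD1 (Ordinal n_gt1)) ?coprime1n //=.
  rewrite !hornerE expr1; apply: lt_le_trans (_ : `|q%:R - z| <= _).
    by apply: le_lt_trans ltz; rewrite normr_nat n1z lerBrDr (ler_nat _ 2).
  rewrite ler_peMr //; elim/big_ind: _ => // [x y|k _]; first exact: mulr_ege1.
  by rewrite !hornerE.
rewrite -(Cintr_Cyclotomic z_prim) (_ : q%:R = intr q%:Z) // horner_map /=.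
rewrite -intr_norm -abszE -pmulrn ltr1n => gt1.
by rewrite gtn_eqF.
Qed.

Let Phi (p d : nat) : int := ('Phi_d).[p%:Z].

Lemma prod_Phi (p n : nat) :
  (0 < n)%N -> (0 < p)%N -> \prod_(d <- divisors n) Phi p d = (p ^ n).-1%:Z.
Proof.
move=> n_gt0 p_gt0; rewrite -horner_prod prod_Cyclotomic // !hornerE.
by rewrite -subn1 -subzn ?expn_gt0 ?p_gt0 // -!natz natrX.
Qed.

(** By Bezout, um = vn + gcd(m, n), and p^(vn) is 1 modulo [N]. *)
Lemma dvdn_pred_exp_gcd (N p m n : nat) : (0 < m)%N -> (0 < p)%N ->
  (N %| (p ^ m).-1 -> N %| (p ^ n).-1 -> N %| (p ^ gcdn m n).-1)%N.
Proof.
move=> m_gt0 p_gt0 Nm Nn; have [u v Duv _] := egcdnP n m_gt0.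
have dvdX k e : (N %| (p ^ k).-1 -> N %| (p ^ (e * k)).-1)%N.
  by move=> /dvdn_trans; apply; rewrite mulnC expnM dvdn_pred_predX.
have := dvdX _ u Nm; rewrite Duv expnD; have := dvdX _ v Nn.
have pn_gt0 k : (0 < p ^ k)%N by rewrite expn_gt0 p_gt0.
rewrite -(prednK (pn_gt0 (v * n)%N)); set y := (p ^ (v * n)).-1.
rewrite -(prednK (pn_gt0 (gcdn m n))); set w := (p ^ gcdn m n).-1.
move=> Ny; rewrite mulSn addSn /= addnC dvdn_addr //.
by rewrite dvdn_mulr.
Qed.

(* Otherwise p^a - 1 would divide the product of the Phi_d(p) over the proper
   divisors d of a, so that Phi_a(p) would be a unit. *)
Lemma primitive_prime_part (p a : nat) : (1 < p)%N -> (1 < a)%N ->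
  exists2 l : nat, prime l &
    forall i, (0 < i < a)%N -> ~~ ((p ^ a).-1`_l %| (p ^ i).-1)%N.
Proof.
move=> p_gt1 a_gt1; have p_gt0 := ltnW p_gt1; have a_gt0 := ltnW a_gt1.
set n := (p ^ a).-1.
have n_gt0: (0 < n)%N by rewrite ltn_predRL -(expn0 p) ltn_exp2l.
pose bad (l : nat) := [forall i : 'I_a, (0 < i)%N ==> ~~ (n`_l %| (p ^ i).-1)%N].
have [/hasP[l pi_l /forallP bad_l]|/hasPn good] := boolP (has bad (primes n)).
  exists l; first by move: pi_l; rewrite mem_primes => /and3P[].
  by move=> i /andP[i_gt0 lt_ia]; apply: (implyP (bad_l (Ordinal lt_ia))).
pose P := \prod_(d <- divisors a | d != a) Phi p d.
have DP: Phi p a * P = n%:Z.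
  by rewrite -(prod_Phi a_gt0 p_gt0) (bigD1_seq a) ?divisors_uniq // -dvdn_divisors.
have: (n %| `|P|)%N.
  apply/(dvdn_partP _ n_gt0) => l /good; rewrite negb_forall => /existsP[i].
  rewrite negb_imply negbK => /andP[i_gt0 dvd_i].
  have dvd_a: (n`_l %| (p ^ a).-1)%N by apply: dvdn_part.
  (* Replacing [i] by the proper divisor g = gcd(a, i) of [a] makes p^g - 1 a subproduct of [P]. *)
  have {dvd_a dvd_i} dvd_g := dvdn_pred_exp_gcd a_gt0 p_gt0 dvd_a dvd_i.
  set g := gcdn a i in dvd_g.
  have g_gt0: (0 < g)%N by rewrite gcdn_gt0 a_gt0.
  have g_a: (g %| a)%N := dvdn_gcdl _ _.
  have lt_ga: (g < a)%N by apply: leq_ltn_trans (dvdn_leq i_gt0 (dvdn_gcdr _ _)) _.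
  apply: dvdn_trans dvd_g _.
  rewrite -[(p ^ g).-1]/(`|(p ^ g).-1%:Z|)%N -(prod_Phi g_gt0 p_gt0).
  have -> : \prod_(d <- divisors g) Phi p d
            = \prod_(d <- divisors a | (d != a) && (d %| g)%N) Phi p d.
    rewrite -[RHS]big_filter; apply: perm_big; apply: uniq_perm.
    - exact: divisors_uniq.
    - by rewrite filter_uniq ?divisors_uniq.
    move=> d; rewrite mem_filter -!dvdn_divisors //.
    apply/idP/andP=> [dg|[/andP[]]//]; split; last exact: dvdn_trans dg g_a.
    by rewrite dg andbT ltn_eqF // (leq_ltn_trans (dvdn_leq g_gt0 dg)).
  by rewrite [P](bigID (fun d => d %| g)%N) abszM dvdn_mulr.
rewrite -[n]/(`|n%:Z|)%N -DP abszM -[X in (_ %| X)%N]mul1n.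
have P_gt0: (0 < `|P|)%N.
  rewrite absz_gt0; apply: contraTneq n_gt0 => P0.
  by move: DP; rewrite P0 mulr0 => -[<-].
rewrite dvdn_pmul2r // dvdn1.
by rewrite (negPf (Cyclotomic_horner_neq a_gt1 p_gt1)).
Qed.

End Zsigmondy.

(** * Semiregular coprime action *)

Section SemiregularPrime.

Import FiniteModule.

(** Acting by [y] permutes the summands cyclically, so the sum is a fixed point of [y]. *)
Lemma cent1_trace0 (gT : finGroupType) (V : {group gT}) (abV : abelian V) l y
    (w : fmod_of abV) :
  y \in 'N(V) -> 'C_V[y] = 1 -> y ^+ l = 1 -> (\sum_(j < l) w ^@ (y ^+ j) = 0)%R.
Proof.
move=> Ny regy yl1; set s := (\sum_(j < l) _)%R.
have sy: (s ^@ y = s)%R.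
  rewrite actr_sum /=; case: l => [|l] in yl1 s *; first by rewrite /s !big_ord0.
  rewrite big_ord_recr /s big_ord_recl /= -actrM ?groupX // -expgSr yl1 addrC.
  by congr (_ + _)%R; apply: eq_bigr => j _; rewrite -actrM ?groupX // -expgSr.
apply: val_inj; rewrite /=; apply/set1P; rewrite -set1gE -regy inE fmodP /=.
apply/cent1P/commgP/conjg_fixP.
by have := fmvalJ s Ny; rewrite sy => /esym.
Qed.

(* If <u> <> <t>, sum the traces (all zero) of x along the subgroups
   <t u^i>, i < l: the terms with j <> 0 regroup into traces along <u^j>, and
   the terms with j = 0 give l x = 0. *)
Lemma semiregular_prime_cycle (gT : finGroupType) (V T : {group gT}) l t u :
    abelian V -> V :!=: 1 -> T \subset 'N(V) -> semiregular V T ->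
    prime l -> coprime #|V| l -> t \in 'Z(T) -> u \in T -> #[t] = l -> #[u] = l ->
  <[u]> = <[t]>.
Proof.
move=> abV /trivgPn[x Vx ntx] nVT regT l_pr coVl /setIP[Tt cTt] Tu ot ou.
apply/eqP; apply: contraNT ntx => neq_ut.
have ctu: commute t u := centP cTt u Tu.
have l_gt0 := prime_gt0 l_pr.
have trace0 y w: y \in T -> y != 1 -> y ^+ l = 1 ->
  (\sum_(j < l) w ^@ (y ^+ j) = 0 :> fmod_of abV)%R.
- move=> Ty nty; apply: cent1_trace0; first exact: (subsetP nVT).
  by apply: regT; rewrite !inE nty.
have nVX y i : y \in T -> y ^+ i \in 'N(V).
  by move=> Ty; rewrite groupX ?(subsetP nVT).
have ul1: u ^+ l = 1 by rewrite -ou expg_order.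
have tl1: t ^+ l = 1 by rewrite -ot expg_order.
pose w := fmod abV x.
have: (\sum_(i < l) \sum_(j < l) w ^@ ((t * u ^+ i) ^+ j) = 0)%R.
  apply: big1 => i _; apply: trace0; first by rewrite groupM ?groupX.
    apply: contra neq_ut => /eqP tui1; rewrite eq_sym eqEcard -!orderE ot ou leqnn.
    rewrite andbT cycle_subG -groupV.
    have /eqP := tui1; rewrite -eq_invg_mul => /eqP->.
    exact: mem_cycle.
  rewrite expgMn; last exact: commuteX.
  by rewrite tl1 mul1g -expgM mulnC expgM ul1 expg1n.
rewrite exchange_big /= (bigD1 (Ordinal l_gt0)) //=.
rewrite [X in (_ + X)%R]big1 => [|j nz_j].
  rewrite addr0 (eq_bigr (fun _ => w)) => [|i _]; last by rewrite expg0 actr1.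
  rewrite sumr_const card_ord => lw0.
  have xl1: x ^+ l = 1 by rewrite -(fmodK abV Vx) -fmvalZ lw0.
  rewrite -order_eq1 -dvdn1 -(eqP coVl) dvdn_gcd order_dvdG //.
  by rewrite order_dvdn xl1 eqxx.
have j_gt0: (0 < j)%N by rewrite lt0n.
transitivity ((\sum_(i < l) w ^@ ((u ^+ j) ^+ i)) ^@ (t ^+ j))%R; last first.
  rewrite trace0 ?act0r ?groupX //; last by rewrite -expgM mulnC expgM ul1 expg1n.
  by rewrite -order_dvdn ou gtnNdvd.
rewrite actr_sum; apply: eq_bigr => i _; rewrite -actrM ?nVX ?groupX //.
congr (_ ^@ _)%R; rewrite expgMn; last exact: commuteX.
rewrite -!expgM mulnC; apply: commuteX2; exact: ctu.
Qed.

End SemiregularPrime.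

(** Take [t] of order [l] in [Z(T)] and p^i the order of R = [K/K', t]; [T] acts semiregularly on
    [R] because every nontrivial element of [T] has a power generating [<[t]>]. *)
Lemma semiregular_der1_dvd (p l : nat) (gT : finGroupType)
    (K N T : {group gT}) :
    prime p -> prime l -> p != l -> p.-group K -> N \subset K -> abelian N ->
    N :!=: 1 -> l.-group T -> T :!=: 1 -> T \subset 'N(K) -> T \subset 'N(N) ->
    semiregular N T ->
  exists i, [/\ 0 < i, p ^ i <= #|K : K^`(1)| & #|T| %| (p ^ i).-1]%N.
Proof.
move=> p_pr l_pr neq_pl pK sNK abN ntN lT ntT nKT nNT regT.
have solK := pgroup_sol pK.
have coKT: coprime #|K| #|T|.
  by apply: pnat_coprime pK _; apply: pi_pnat lT _; rewrite !inE eq_sym.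
have ntZ: 'Z(T) != 1 by rewrite center_nil_eq1 // (pgroup_nil lT).
have [_ l_T _] := pgroup_pdiv lT ntT.
have [_ l_Z _] := pgroup_pdiv (pgroupS (center_sub T) lT) ntZ.
have [t Zt ot] := Cauchy l_pr l_Z.
have Tt: t \in T := subsetP (center_sub T) t Zt.
have ntt: t != 1 by rewrite -order_gt1 ot prime_gt1.
have sKK: K^`(1) \subset K := der_sub 1 K.
have nKK: K \subset 'N(K^`(1)) := der_norm 1 K.
have nDT: T \subset 'N(K^`(1)) := char_norm_trans (der_char 1 K) nKT.
have stT: <[t]> \subset T by rewrite cycle_subG.
have coKt: coprime #|K| #|<[t]>| := coprimegS stT coKT.
pose Kb := (K / K^`(1))%G; pose Tb := (T / K^`(1))%G.
pose tb := (<[t]> / K^`(1))%G; pose R := [~: Kb, tb]%G.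
have nKtb: tb \subset 'N(Kb) by rewrite quotient_norms ?(subset_trans stT).
have coKtb: coprime #|Kb| #|tb| by rewrite coprime_morph.
have abKb: abelian Kb := sub_der1_abelian (subxx _).
have sRK: R \subset Kb by rewrite commg_subl.
have ctT: T \subset 'C(<[t]>).
  by rewrite cent_cycle sub_cent1 (subsetP (subsetIr T _)).
have nRT: Tb \subset 'N(R).
  apply: normsR; first exact: quotient_norms.
  by rewrite cents_norm // quotient_cents.
have tiRt: 'C_R(tb) = 1 by apply: coprime_abel_cent_TI.
(* If [t] centralised K/K', then K = C_K(t) Phi(K), so [t] would centralise [K] and with it [N]. *)
have ntR: R :!=: 1.
  apply/negP=> /eqP/commG1P cKt.
  have defK: 'C_K(<[t]>) / K^`(1) = K / K^`(1).
    rewrite coprime_quotient_cent ?(subset_trans stT) //.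
    exact/setIidPl.
  have: <<'C_K(<[t]>)>> = K.
    apply: Phi_nongen; apply/eqP; rewrite eqEsubset join_subG Phi_sub subsetIl /=.
    have sKP: K^`(1) \subset 'Phi(K) by rewrite (Phi_joing pK) joing_subl.
    rewrite -(quotientSGK nKK) ?(subset_trans sKP (joing_subl _ _)) //.
    by rewrite -defK quotientS ?joing_subr.
  rewrite genGid => defCK; have [n Nn ntn] := trivgPn _ ntN; case/negP: ntn.
  have: n \in 'C_N[t].
    rewrite inE Nn /= -cent_cycle; apply: subsetP n Nn.
    by rewrite (subset_trans sNK) // -defCK subsetIr.
  by rewrite regT ?inE ?ntt // => /set1P->.
have [i oR] := p_natP (pgroupS sRK (quotient_pgroup _ pK)).
exists i; split.
- by rewrite lt0n; apply: contra ntR => /eqP i0; rewrite trivg_card1 oR i0.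
- by rewrite -oR -card_quotient // subset_leq_card.
have tiKT: K^`(1) :&: T = 1.
  by apply: coprime_TIg; apply: coprimeSg coKT.
have -> : #|T| = #|Tb| by rewrite -(card_isog (quotient_isog nDT tiKT)).
rewrite -oR; apply: regular_norm_dvd_pred nRT _ => ub /setD1P[ntu].
case/morphimP=> u nKu Tu /= Du.
apply/trivgP; rewrite -tiRt /= setIS // -cent_cycle centS // Du -quotient_cycle //.
have ntu' : u != 1 by apply: contraNneq ntu => u1; rewrite Du u1 morph1.
have sul : l %| #[u].
  have: l.-elt u by apply: mem_p_elt lT Tu.
  case/p_natP=> [[|e] oe]; last by rewrite oe expnS dvdn_mulr.
  by rewrite -order_eq1 oe in ntu'.
pose k := (#[u] %/ l)%N.
have ouk: #[u ^+ k] = l.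
  by rewrite orderXdiv ?dvdn_div // divnA ?mulKn ?order_gt0.
have defu: <[u ^+ k]> = <[t]>.
  have coNl : coprime #|N| l.
    by apply: coprime_dvdr l_T (coprimeSg sNK coKT).
  have Tuk := groupX k Tu.
  exact: semiregular_prime_cycle abN ntN nNT regT l_pr coNl Zt Tuk ot ouk.
by rewrite quotientS // -defu cycle_subG mem_cycle.
Qed.

(** * The large character *)

Section LargeDegree.

Local Open Scope ring_scope.
Import Num.Theory Order.TTheory.

Lemma char1_ge_mult (gT : finGroupType) (G : {group gT}) (phi : 'CF(G)) i :
  phi \is a character -> '[phi, 'chi_i] * 'chi_i 1%g <= phi 1%g.
Proof.
move=> Nphi; rewrite {2}[phi]cfun_sum_cfdot sum_cfunE (bigD1 i) //= cfunE.
rewrite lerDl sumr_ge0 // => j _.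
by rewrite cfunE mulr_ge0 ?char1_ge0 ?irr_char // natr_ge0 // Cnat_cfdot_char_irr.
Qed.

Variables (p a : nat) (gT : finGroupType) (G P : {group gT}) (i : Iirr G).
Let q := (p ^ a)%N.
Hypotheses (p_pr : prime p) (a_gt0 : (0 < a)%N).
Hypothesis oG : #|G| = (q ^ 3 * q.-1)%N.
Hypothesis chi1 : 'chi_i 1%g = (q * q.-1)%:R.
Hypothesis sylP : p.-Sylow(G) P.

Let sPG : P \subset G := pHall_sub sylP.

Let q_gt1 : (1 < q)%N.
Proof. by rewrite -(expn0 p) ltn_exp2l ?prime_gt1. Qed.

Let q_gt0 : (0 < q)%N := ltnW q_gt1.

Let q1_gt0 : (0 < q.-1)%N.
Proof. by rewrite ltn_predRL. Qed.

Let co_p_q1 : coprime p q.-1.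
Proof.
by rewrite -(coprime_pexpl _ _ a_gt0) -/q -{1}(prednK q_gt0) coprimeSn.
Qed.

Lemma card_Sylow_q : #|P| = (q ^ 3)%N.
Proof.
have q3_gt0: (0 < q ^ 3)%N by rewrite expn_gt0 q_gt0.
rewrite (card_Hall sylP) oG partnM //.
rewrite part_pnat_id; last by rewrite /q -expnM pnatX pnat_id.
by rewrite part_p'nat ?muln1 // p'natE // -prime_coprime.
Qed.

Lemma index_Sylow_q : #|G : P| = q.-1.
Proof.
by rewrite -divgS // oG card_Sylow_q mulKn // expn_gt0 q_gt0.
Qed.

Let qC_gt0 : 0 < q%:R :> algC. Proof. by rewrite ltr0n. Qed.

Let Rchi := 'Res[P] 'chi_i.
Let Rchi_char : Rchi \is a character := cfRes_char P (irr_char i).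

(** The character induced from ['chi_j] has degree (q - 1) ['chi_j](1) and contains ['chi_i], of
    degree q(q - 1), with the same multiplicity. *)
Lemma Sylow_constt_le j : q%:R * '[Rchi, 'chi_j] <= 'chi_j 1%g.
Proof.
have Nind: 'Ind[G] 'chi_j \is a character by rewrite cfInd_char ?irr_char.
have := char1_ge_mult i Nind; rewrite cfInd1 // index_Sylow_q chi1.
rewrite -cfdot_Res_r cfdotC_char ?irr_char // natrM mulrA [leRHS]mulrC.
by rewrite ler_pM2r ?ltr0n // mulrC.
Qed.

(** When the multiplicity is not 0, the degree is a power of [p] that is at least [q]. *)
Lemma Sylow_constt_dvd j : '[Rchi, 'chi_j] * 'chi_j 1%g / q%:R \is a Num.nat.
Proof.
have /natrP[m Dm] := Cnat_cfdot_char_irr j Rchi_char.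
have /natrP[d Dd] := Cnat_irr1 j.
have := Sylow_constt_le j; rewrite Dm Dd -natrM ler_nat => le_qm.
case: m => [|m] in Dm le_qm *; first by rewrite !mul0r.
have d_p: p.-nat d.
  have := dvd_irr1_cardG j; rewrite Dd dvdC_nat => /pnat_dvd; apply.
  exact: pHall_pgroup sylP.
have [k Dk] := p_natP d_p.
have le_qd: (q <= d)%N by apply: leq_trans le_qm; rewrite leq_pmulr.
have /dvdnP[e ->] : (q %| d)%N.
  by move: le_qd; rewrite Dk /q leq_exp2l ?prime_gt1 //; apply: dvdn_exp2l.
by rewrite natrM mulrA mulfK ?natr_nat -?natrM // pnatr_eq0 -lt0n.
Qed.

Lemma norm_chi_leq z : z \in P^#%g -> `|'chi_i z| <= q%:R.
Proof.
case/setD1P=> ntz Pz.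
(* These are the multiplicities in reg_P - q chi|P, whose degree is q^3 - q^2(q - 1) = q^2 and whose
   value at [z] is -q chi(z). *)
pose b j : algC := 'chi_j 1%g - q%:R * '[Rchi, 'chi_j].
have b_ge0 j: 0 <= b j by rewrite subr_ge0 Sylow_constt_le.
have sumb x: x \in P ->
    \sum_j b j * 'chi_j x = cfReg P x - q%:R * 'chi_i x.
  move=> Px; rewrite -(cfResE _ sPG Px) -/Rchi cfReg_sum.
  rewrite [in RHS](cfun_sum_cfdot Rchi).
  rewrite !sum_cfunE mulr_sumr -sumrB; apply: eq_bigr => j _.
  by rewrite !cfunE mulrBl mulrA.
have: `|\sum_j b j * 'chi_j z| <= \sum_j `|b j * 'chi_j z| by apply: ler_norm_sum.
rewrite sumb // cfRegE (negPf ntz) mulr0n sub0r normrN normrM normr_nat.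
have le1: \sum_j `|b j * 'chi_j z| <= \sum_j b j * 'chi_j 1%g.
  apply: ler_sum => j _; rewrite normrM ger0_norm // ler_wpM2l //.
  by rewrite char1_ge_norm ?irr_char.
move/le_trans/(_ le1); rewrite sumb ?group1 // cfRegE eqxx chi1 card_Sylow_q.
rewrite mulr1n -natrM -natrB.
  have ->: (q ^ 3 - q * (q * q.-1) = q * q)%N.
    by rewrite !expnS expn0 muln1 -!mulnBr -subn1 subKn ?muln1.
  by rewrite natrM ler_pM2l.
by rewrite !expnS expn0 muln1 !leq_mul // leq_pred.
Qed.

Let q_neq0 : q%:R != 0 :> algC. Proof. by rewrite gt_eqF. Qed.

(** An irreducible character of [P] restricts to a central subgroup as its degree times a linear
    character. *)
Lemma Res_center_dvd (Z : {group gT}) : Z \subset 'Z(P) ->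
  exists2 theta : 'CF(Z), theta \is a character & 'Res 'chi_i = q%:R *: theta.
Proof.
move=> sZZ; have sZP := subset_trans sZZ (center_sub P).
have lam j: exists2 mu : 'CF(Z), mu \is a character
    & 'Res[Z] 'chi[P]_j = 'chi_j 1%g *: mu.
  have [mu Lmu Dmu] := cfcenter_Res 'chi_j.
  have sZj: Z \subset 'Z('chi_j)%CF.
    by rewrite (subset_trans sZZ) // -cap_cfcenter_irr (bigcap_inf j).
  exists ('Res[Z] mu); first by rewrite cfRes_char ?lin_charW.
  by rewrite -linearZ -Dmu /= cfResRes ?cfcenter_sub.
have [mu Nmu Dmu] := fin_all_exists2 lam.
exists (\sum_j ('[Rchi, 'chi_j] * 'chi_j 1%g / q%:R) *: mu j).
  by apply: rpred_sum => j _; rewrite rpredZ_nat ?Sylow_constt_dvd.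
rewrite -(cfResRes 'chi_i sZP sPG) -/Rchi [Rchi in LHS]cfun_sum_cfdot.
rewrite linear_sum scaler_sumr; apply: eq_bigr => j _.
rewrite linearZ /= Dmu !scalerA; congr (_ *: _).
by rewrite [RHS]mulrC mulfVK // gt_eqF.
Qed.

(* p [theta, theta] = (q - 1)^2 + s where s, a sum of p - 1 terms in [0, 1], must
   be -1 modulo p. *)
Lemma norm_chi_center z : z \in 'Z(P) -> #[z]%g = p -> `|'chi_i z| = q%:R.
Proof.
move=> Zz oz; have Pz := subsetP (center_sub P) z Zz.
have ntz: z != 1%g by rewrite -order_gt1 oz prime_gt1.
have sZZ: <[z]> \subset 'Z(P) by rewrite cycle_subG.
have sZP := subset_trans sZZ (center_sub P).
have [theta Ntheta Dtheta] := Res_center_dvd sZZ.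
have chiE y : y \in <[z]> -> 'chi_i y = q%:R * theta y.
  move=> Zy; rewrite -(cfResE 'chi_i (subset_trans sZP sPG) Zy) Dtheta.
  by rewrite cfunE.
have theta1: theta 1%g = q.-1%:R.
  by apply: (mulfI q_neq0); rewrite -chiE // chi1 natrM.
have le1 y : y \in <[z]>^#%g -> `|theta y| <= 1.
  case/setD1P=> nty Zy; rewrite -(ler_pM2l qC_gt0) mulr1.
  rewrite -{1}(ger0_norm (ltW qC_gt0)) -normrM -chiE // norm_chi_leq //.
  by rewrite !inE nty (subsetP sZP).
have /natrP[m Dm] := Cnat_cfdot_char Ntheta Ntheta.
have: p%:R * m%:R = q.-1%:R ^+ 2 + \sum_(y in <[z]>^#%g) `|theta y| ^+ 2.
  rewrite -Dm cfdotE -orderE oz mulVKf; last by rewrite pnatr_eq0 -lt0n prime_gt0.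
  rewrite (bigD1 1%g) //= theta1 -normCK normr_nat; congr (_ + _).
  by apply: eq_big => [y|y _]; rewrite ?normCK // !inE andbC.
set s := \sum_(y in _) _ => Ds.
have [s_ge0 s_le] : 0 <= s /\ s <= p.-1%:R.
  split; first by apply: sumr_ge0 => y _; rewrite exprn_ge0.
  have ->: p.-1%:R = \sum_(y in <[z]>^#%g) 1 :> algC.
    by rewrite sumr_const -oz orderE (cardsD1 1%g <[z]>) group1.
  by apply: ler_sum => y Zy; rewrite expr_le1 ?le1.
have ge_m: (q.-1 ^ 2 <= p * m)%N.
  by rewrite -(ler_nat algC) natrM natrX Ds lerDl.
have le_m: (p * m <= q.-1 ^ 2 + p.-1)%N.
  by rewrite -(ler_nat algC) natrD natrM natrX Ds lerD2l.
have dvd_p: (p %| q.-1 ^ 2 + p.-1)%N.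
  have p_q: (p %| q)%N by apply: dvdn_exp.
  have ->: (q.-1 ^ 2 + p.-1 = (q.-1 ^ 2 - 1 ^ 2) + p)%N.
    have X_gt0: (0 < q.-1 ^ 2)%N by rewrite expn_gt0 q1_gt0.
    by rewrite exp1n -{1}(subnK X_gt0) -addnA add1n prednK ?prime_gt0.
  by rewrite subn_sqr addn1 prednK // dvdn_addl // dvdn_mull.
(* Among the [p] consecutive integers from (q - 1)^2 on, only the last is a multiple of [p]. *)
have Dpm: (p * m = q.-1 ^ 2 + p.-1)%N.
  apply/eqP; rewrite eqn_leq le_m -subn_eq0 -leqn0 leqNgt; apply/negP=> gt0.
  have := dvdn_leq gt0 (dvdn_sub dvd_p (dvdn_mulr m (dvdnn p))).
  apply/negP; rewrite -ltnNge (@leq_ltn_trans p.-1) ?prednK ?prime_gt0 //.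
  by rewrite leq_subLR leq_add2r.
have Dsp: s = p.-1%:R.
  by apply: (addrI (q.-1%:R ^+ 2)); rewrite -Ds -natrM Dpm natrD natrX.
have zz : z \in <[z]>^#%g by rewrite !inE ntz cycle_id.
have sum0: \sum_(y in <[z]>^#%g) (1 - `|theta y| ^+ 2) = 0.
  rewrite sumrB -/s Dsp sumr_const -oz orderE (cardsD1 1%g <[z]>) group1.
  by rewrite subrr.
have ge0 y : y \in <[z]>^#%g -> 0 <= 1 - `|theta y| ^+ 2.
  by move=> Zy; rewrite subr_ge0 expr_le1 ?le1.
have /eqP := psumr_eq0P ge0 sum0 zz.
rewrite subr_eq0 eq_sym sqrp_eq1 // => /eqP theta_z.
by rewrite chiE ?cycle_id // normrM theta_z mulr1 normr_nat.
Qed.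

Variable z : gT.
Hypotheses (Zz : z \in 'Z(P)) (oz : #[z]%g = p).

Let Gz : z \in G.
Proof. exact: subsetP (subset_trans (center_sub P) sPG) z Zz. Qed.

Let ntz : z != 1%g.
Proof. by rewrite -order_gt1 oz prime_gt1. Qed.

(* The central character value w at z^G has |w|^2 = (|z^G| / (q - 1))^2, a
   rational algebraic integer. *)
Lemma card_class_center : #|z ^: G| = q.-1.
Proof.
have chi_z := norm_chi_center Zz oz.
have dvd_m: (#|z ^: G| %| q.-1)%N.
  rewrite -index_cent1 -index_Sylow_q; apply: indexgS.
  by rewrite subsetI sPG sub_cent1; case/setIP: Zz.
have := Aint_class_div_irr1 i Gz; set m := #|_| in dvd_m *.
have m_gt0: (0 < m)%N := dvdn_gt0 q1_gt0 dvd_m.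
set w := _ / _ => Aw.
have Dw: `|w| = m%:R / q.-1%:R.
  rewrite normf_div normrM chi_z chi1 !normr_nat natrM invfM.
  by rewrite mulrA mulfK.
have Zw: `|w| ^+ 2 \is a Num.int.
  apply: Cint_rat_Aint; first by rewrite Dw rpredX // rpred_div ?rpred_nat.
  by rewrite normCK rpredM // Aint_aut.
apply/eqP; rewrite eqn_leq dvdn_leq //=.
have w_ge1: 1 <= `|w| ^+ 2.
  have w_neq0: `|w| ^+ 2 != 0.
    by rewrite Dw expf_neq0 // mulf_neq0 ?invr_eq0 // pnatr_eq0 -lt0n.
  by rewrite -(ger0_norm (exprn_ge0 2 (normr_ge0 w))) norm_intr_ge1.
move: w_ge1; rewrite expr_ge1 ?normr_ge0 // Dw ler_pdivlMr ?ltr0n //.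
by rewrite mul1r ler_nat.
Qed.

(** The identity and the class of [z] already contribute q^2(q - 1)^2 + (q - 1)q^2 = |G| to the sum
    of |chi|^2. *)
Lemma chi_center_support x :
  x \in G -> x != 1%g -> x \notin z ^: G -> 'chi_i x = 0.
Proof.
move=> Gx ntx nzx.
have nz1: 1%g \notin z ^: G by rewrite class_sym class1G inE.
have : #|G|%:R = \sum_(y in G) `|'chi_i y| ^+ 2.
  have := cfnorm_irr i; rewrite cfdotE => /(congr1 ( *%R #|G|%:R)).
  rewrite mulVKf ?neq0CG // mulr1 => <-.
  by apply: eq_bigr => y _; rewrite normCK.
rewrite (bigD1 1%g) //= (bigID [in z ^: G]) /=.
rewrite chi1 normr_nat (eq_bigl [in z ^: G]) => [|y]; last first.
  apply: andb_idl => zy.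
  by rewrite (subsetP (class_subG Gz (subxx G))) // (memPn nz1).
rewrite (eq_bigr (fun=> q%:R ^+ 2)) => [|_ /imsetP[g Gg ->]]; last first.
  by rewrite cfunJ // norm_chi_center.
rewrite sumr_const card_class_center addrA.
rewrite -!natrX -mulrnA -natrD oG.
have -> : ((q * q.-1) ^ 2 + q ^ 2 * q.-1 = q ^ 3 * q.-1)%N.
  rewrite expnMn -mulnDr -[(q.-1 ^ 2)%N]mulnn -mulnSr prednK //.
  by rewrite (mulnC q.-1) mulnA -expnSr.
move/(canLR (addKr _)); rewrite addNr => /esym sum0.
have: `|'chi_i x| ^+ 2 = 0.
  by apply: (psumr_eq0P _ sum0) => // [y _|]; rewrite ?exprn_ge0 // Gx ntx.
by move/eqP; rewrite expf_eq0 /= normr_eq0 => /eqP.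
Qed.

(** Orthogonality to the trivial character gives q(q - 1) + (q - 1)chi(z) = 0. *)
Lemma chi_center : 'chi_i z = - q%:R.
Proof.
have nz1: 1%g \notin z ^: G by rewrite class_sym class1G inE.
have i_neq0: i != 0.
  apply/eqP=> i0; have := chi1; rewrite i0 irr0 cfun11 => /eqP.
  by rewrite (eqr_nat _ 1) eq_sym muln_eq1 gtn_eqF.
have : \sum_(y in G) 'chi_i y = 0.
  have := cfdot_irr i 0; rewrite (negPf i_neq0) irr0 cfdotE.
  move/eqP; rewrite mulf_eq0 invr_eq0 (negPf (neq0CG G)) /= => /eqP sum0.
  rewrite -[RHS]sum0; apply: eq_bigr => y Gy.
  by rewrite cfun1E Gy rmorph1 mulr1.
rewrite (bigD1 1%g) //= (bigID [in z ^: G]) /=.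
rewrite (eq_bigl [in z ^: G]) => [|y]; last first.
  apply: andb_idl => zy.
  by rewrite (subsetP (class_subG Gz (subxx G))) // (memPn nz1).
rewrite [X in _ + (_ + X)]big1 => [|y /andP[/andP[Gy nty] nzy]]; last first.
  exact: chi_center_support.
rewrite (eq_bigr (fun=> 'chi_i z)) => [|_ /imsetP[g Gg ->]]; last by rewrite cfunJ.
rewrite sumr_const card_class_center addr0 chi1 natrM.
rewrite -['chi_i z *+ _]mulr_natr -mulrDl.
move/eqP; rewrite mulf_eq0 pnatr_eq0 (gtn_eqF q1_gt0) orbF addrC addr_eq0.
by move/eqP.
Qed.

Lemma class_center_normal :
  exists N : {group gT}, N <| G /\ N^#%g = z ^: G.
Proof.
(* [Delta] collects the other irreducible characters. Its degree is q chi(1), so a nontrivial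
   element lies in its kernel exactly when chi takes the value -q there. *)
pose Delta := cfReg G - 'chi_i 1%g *: 'chi_i.
have NDelta: Delta \is a character.
  rewrite /Delta cfReg_sum (bigD1 i) //= addrC addrK.
  by apply: rpred_sum => j _; rewrite rpredZ_nat ?Cnat_irr1 ?irr_char.
exists (cfker_group Delta); split; first exact: cfker_normal.
have Delta1: Delta 1%g = 'chi_i 1%g * q%:R.
  rewrite cfunE cfRegE !cfunE eqxx mulr1n oG chi1 -natrM -natrM -natrB.
    have q1E: (q - q.-1 = 1)%N by rewrite -subn1 subKn.
    congr (_%:R); rewrite !expnS expn0 muln1 -!mulnA -mulnBr -mulnBl q1E mul1n.
    by rewrite [(q.-1 * q)%N]mulnC.
  by rewrite !expnS expn0 muln1 -!mulnA leq_mul2l mulnCA leq_mul2l leq_mul2r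
             leq_pred !orbT.
have q_chi1: 'chi_i 1%g != 0 by rewrite irr1_neq0.
have chi_class y : y \in z ^: G -> 'chi_i y = - q%:R.
  by move=> /imsetP[g Gg ->]; rewrite cfunJ // chi_center.
apply/setP=> x; rewrite /= cfkerEchar // !inE.
have [->|ntx] /= := eqVneq x 1%g; first by rewrite class_sym class1G inE (negPf ntz).
rewrite Delta1 cfunE cfRegE !cfunE (negPf ntx) mulr0n sub0r -mulrN.
rewrite (inj_eq (mulfI q_chi1)).
have [zx|nzx] := boolP (x \in z ^: G).
  by rewrite chi_class // opprK eqxx (subsetP (class_subG Gz (subxx G))).
apply/negP=> /andP[Gx]; rewrite chi_center_support // oppr0.
by rewrite eq_sym (negPf q_neq0).
Qed.

End LargeDegree.

(** * Isaacs groups of prime power degree *)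

Lemma irr1_leq_abelian_index (gT : finGroupType) (G A : {group gT})
    (i : Iirr G) :
  A \subset G -> abelian A -> ('chi_i 1%g <= #|G : A|%:R)%R.
Proof.
move=> sAG abA; have [j] := constt_cfRes_irr A i.
rewrite -constt_Ind_Res => ij.
have /lin_char1 j1 := char_abelianP A abA j.
have Nind: ('Ind[G] 'chi_j)%R \is a character by rewrite cfInd_char ?irr_char.
by have := char1_ge_constt Nind ij; rewrite cfInd1 // j1 mulr1.
Qed.

Theorem theorem1 (p a : nat) (gT : finGroupType) (G N K : {group gT})
    (hp : prime p) (ha : (1 <= a)%N)
    (hG : isaacs_group (p ^ a)%N G)
    (hN : unique_minimal_normal N G)
    (hK : K = 'O_p(G)%G) :
  [/\ (p ^ a < #|K : N| <= p ^ (2 * a))%N,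
      N \subset 'Z(K),
      ~~ abelian K
    & (p ^ a <= #|K : K^`(1)|)%N].
Proof.
have [q_gt1 oG [i chi1]] := hG; set q := (p ^ a)%N in q_gt1 oG chi1 *.
have q_gt0 := ltnW q_gt1.
have q1_gt0: (0 < q.-1)%N by rewrite ltn_predRL.
have {}oG: #|G| = (q ^ 3 * q.-1)%N.
  by rewrite oG expnSr -{2}[(q ^ 3)%N]muln1 -mulnBr subn1.
have {}chi1: ('chi_i 1%g = (q * q.-1)%:R)%R.
  by rewrite chi1 -mulnn -{3}[q]muln1 -mulnBr subn1.
have [P sylP] := Sylow_exists p G.
have pP := pHall_pgroup sylP.
have oP := card_Sylow_q hp ha oG sylP.
have ntZ: 'Z(P) != 1.
  by rewrite center_nil_eq1 ?(pgroup_nil pP) // -cardG_gt1 oP -(exp1n 3) ltn_exp2r.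
have [_ p_Z _] := pgroup_pdiv (pgroupS (center_sub P) pP) ntZ.
have [z Zz oz] := Cauchy hp p_Z.
have ntz: z != 1 by rewrite -order_gt1 oz prime_gt1.
have ozG := card_class_center hp ha oG chi1 sylP Zz oz.
have [N1 [nsN1G defN1]] := class_center_normal hp ha oG chi1 sylP Zz oz.
have minN1: minimal_normal N1 G.
  apply/mingroupP; split.
    rewrite nsN1G andbT; apply/trivgPn; exists z => //.
    have: z \in N1^# by rewrite defN1 class_refl.
    by case/setD1P.
  move=> M /andP[ntM nsMG] sMN1; apply/eqP; rewrite eqEsubset sMN1 /=.
  have [x Mx ntx] := trivgPn _ ntM.
  have: x \in N1^# by rewrite !inE ntx (subsetP sMN1).
  rewrite defN1 => zx; apply/subsetP=> y N1y.
  have [->//|nty] := eqVneq y 1.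
  have: y \in N1^# by rewrite !inE nty.
  rewrite defN1 -(class_eqP zx) => /imsetP[g Gg ->].
  by rewrite memJ_norm // (subsetP (normal_norm nsMG)).
have eqN := hN.2 N1 minN1; rewrite {N1}eqN in nsN1G defN1 minN1.
have oN: #|N| = q by rewrite (cardsD1 1) group1 defN1 ozG add1n prednK.
have pN: p.-group N by rewrite /pgroup oN pnatX pnat_id.
have ntN: N :!=: 1 by rewrite -cardG_gt1 oN.
have pK: p.-group K by rewrite hK pcore_pgroup.
have nsKG: K <| G by rewrite hK pcore_normal.
have sNK: N \subset K by rewrite hK pcore_max.
have sNZ: N \subset 'Z(K).
  have nsNK: N <| K := normalS sNK (normal_sub nsKG) nsN1G.
  have ntI := meet_center_nil (pgroup_nil pK) nsNK ntN.
  have nsIG: (N :&: 'Z(K)) <| G.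
    by rewrite normalI // (char_normal_trans (center_char K)).
  have [_ /(_ (N :&: 'Z(K))%G)] := mingroupP minN1.
  by rewrite ntI nsIG subsetIl => /(_ isT isT) <-; apply: subsetIr.
have abN: abelian N := abelianS sNZ (center_abelian K).
have class_N v : v \in N^# -> v ^: G = z ^: G.
  by rewrite defN1 => /class_eqP.
have cent_N v : v \in N^# -> #|'C_G[v]| = (q ^ 3)%N.
  move=> Nv; apply/eqP; rewrite -(eqn_pmul2r q1_gt0) -oG.
  by rewrite -ozG -(class_N v Nv) -index_cent1 Lagrange ?subsetIl.
have pC v : v \in N^# -> p.-group 'C_G[v].
  by move=> Nv; rewrite /pgroup cent_N // -expnM pnatX pnat_id.
have N1z: z \in N^# by rewrite defN1 class_refl.
have Nz: z \in N by case/setD1P: N1z.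
have sCz: 'C_G(N) \subset 'C_G[z].
  by rewrite setIS // -cent_set1 centS // sub1set.
have nNG := normal_norm nsN1G.
(* [C_G(N)] is a normal p-subgroup, since the stabiliser of a point of [N^#] has order q^3. *)
have CN_K: 'C_G(N) = K.
  apply/eqP; rewrite eqEsubset; apply/andP; split.
    rewrite hK pcore_max ?(pgroupS sCz (pC z N1z)) //.
    by rewrite /normal subsetIl normsI ?normG ?norms_cent.
  rewrite subsetI normal_sub //= centsC (subset_trans sNZ) //.
  exact: subsetIr.
have hGN: pstab_transitive p G N.
  split=> // [u v|v Nv].
    rewrite !defN1 => zu; rewrite -(class_eqP zu) => /imsetP[g Gg ->].
    by exists g.
  by apply: pnat_dvd (dvdn_indexg _ _) (pC v Nv).
have leK: (q ^ 2 * p <= #|K|)%N.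
  have ntcz: <[z]> != 1 by rewrite cycle_eq1.
  have szN: <[z]> \subset N by rewrite cycle_subG.
  have := centmeas_leq hp hGN szN ntcz; rewrite /centmeas CN_K cent_cycle.
  by rewrite cent_N // oN -orderE oz expnSr mulnAC leq_pmul2r.
have oK: #|K| = (q * #|K : N|)%N by rewrite -oN Lagrange.
(* The factor [p], coming from the order of [z], makes the bound strict. *)
have ltK: (q ^ 2 < #|K|)%N.
  apply: leq_trans leK; rewrite -[ltnLHS]muln1 ltn_pmul2l ?prime_gt1 //.
  by rewrite expn_gt0 q_gt0.
have leKP: (#|K| <= q ^ 3)%N.
  by rewrite -oP hK subset_leq_card // pcore_sub_Hall.
split=> //.
- move: ltK leKP; rewrite oK -mulnn ltn_pmul2l // => -> /=.
  by rewrite expnS leq_pmul2l // mulnC expnM.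
- apply/negP=> abK; have := irr1_leq_abelian_index i (normal_sub nsKG) abK.
  rewrite chi1 Num.Theory.ler_nat leqNgt => /negP[].
  rewrite -(ltn_pmul2l (cardG_gt0 K)) (Lagrange (normal_sub nsKG)) oG.
  by rewrite mulnA ltn_pmul2r // expnSr ltn_pmul2r.
rewrite leqNgt; apply/negP=> lt_der.
have ntK: K :!=: 1 by apply: contra ntN; rewrite -!subG1; apply: subset_trans.
(* For a = 1 the bound only says that the nontrivial p-group [K] differs from its derived
   subgroup. *)
have a_gt1: (1 < a)%N.
  rewrite ltn_neqAle ha andbT eq_sym; apply: contraTneq lt_der => a1.
  rewrite -leqNgt /q a1 expn1.
  have [k Dk] := p_natP (pnat_dvd (dvdn_indexg K K^`(1)) pK).
  have := sol_der1_proper (pgroup_sol pK) (subxx K) ntK.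
  rewrite properE -(indexg_eq1 K) Dk.
  case: k {Dk} => [|k]; first by rewrite eqxx andbF.
  by rewrite expnS leq_pmulr // expn_gt0 prime_gt0.
have [l l_pr prim_l] := primitive_prime_part (prime_gt1 hp) a_gt1.
have [T sylT] := Sylow_exists l G.
have lT := pHall_pgroup sylT; have sTG := pHall_sub sylT.
have l_q1: (q.-1`_l != 1)%N.
  apply: contraTneq (prim_l 1%N a_gt1) => q1l.
  by rewrite -/q q1l dvd1n.
have neq_pl: p != l.
  apply: contra l_q1 => /eqP <-; rewrite part_p'nat // p'natE //.
  rewrite -prime_coprime // -(coprime_pexpl _ _ ha) -/q -{1}(prednK q_gt0).
  by rewrite coprimeSn.
have oT: #|T| = (q.-1`_l)%N.
  have q3_gt0: (0 < q ^ 3)%N by rewrite expn_gt0 q_gt0.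
  rewrite (card_Hall sylT) oG partnM //.
  rewrite [X in (X * _)%N]part_p'nat ?mul1n //.
  by rewrite /q -expnM pnatX pnatE // !inE neq_pl.
have ntT: T :!=: 1 by rewrite trivg_card1 oT.
(* Point stabilisers on [N^#] are p-groups, while [T] is an l-group with [l] different from [p]. *)
have regT: semiregular N T.
  move=> u /setD1P[ntu Tu]; apply/trivgP/subsetP=> n /setIP[Nn cun].
  rewrite inE; apply: contraR ntu => ntn.
  have N1n: n \in N^# by rewrite !inE ntn.
  have pu: p.-elt u.
    by apply: mem_p_elt (pC n N1n) _; rewrite inE (subsetP sTG) // cent1C.
  rewrite -order_eq1; apply/eqP; apply: (pnat_1 pu).
  by apply: pi_pnat (mem_p_elt lT Tu) _; rewrite !inE eq_sym.
have [j [j_gt0 le_j dvd_j]] := semiregular_der1_dvd hp l_pr neq_pl pK sNK abN ntN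
  lT ntT (subset_trans sTG (normal_norm nsKG)) (subset_trans sTG nNG) regT.
have lt_ja: (j < a)%N.
  by rewrite -(ltn_exp2l _ _ (prime_gt1 hp)) (leq_ltn_trans le_j).
by have := prim_l j; rewrite j_gt0 lt_ja -/q -oT dvd_j => /(_ isT).
Qed.
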